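(* Let $n\geq 3$. (a) If $2\leq k\leq \lceil n/2\rceil$, then any two distinct trees on the same $n$-vertex vertex set have distinct families of connected $k$-sets. (b) If $\lceil n/2\rceil+1\leq k\leq n$, then for every path $P$ on an $n$-vertex vertex set $V$ there is a path $P'\neq P$ on vertex set $V$ with the same family of connected $k$-sets as $P$.
   Context: For a graph $G=(V,E)$ and $k\geq 2$, the connected $k$-sets of $G$ are the sets $X\subseteq V$ with $|X|=k$ such that $G[X]$ is connected. Graphs are labelled: two graphs on the same vertex set are equal iff they have the same edge set. *)

(* Defs.v *)
From HB Require Import structures.
From mathcomp Require Import all_boot.

Set Implicit Arguments.
Unset Strict Implicit.
Unset Printing Implicit Defensive.

(* The two-element-edge condition is boolean, so Leibniz equality of labelled
   graphs on V is equality of their edge sets (sgraph_eq below). *)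
Record sgraph (V : finType) := SGraph {
  edges : {set {set V}};
  edges_card2 : [forall e in edges, #|e| == 2]
}.

HB.instance Definition _ (V : finType) := [isSub for @edges V].

Lemma sgraph_eq (V : finType) (G H : sgraph V) : edges G = edges H <-> G = H.
Proof. by split=> [/val_inj | ->]. Qed.

Section Graphs.

Variables (V : finType) (G : sgraph V).

Definition adj : rel V := [rel x y | [set x; y] \in edges G].

Lemma adj_sym : symmetric adj.
Proof. by move=> x y; rewrite /adj /= setUC. Qed.

Lemma adj_irrefl : irreflexive adj.
Proof.
move=> x; apply/negP => /= xx; have /forall_inP/(_ _ xx) := edges_card2 G.
by rewrite setUid cards1.
Qed.

Definition induced_adj (X : {set V}) : rel V :=
  [rel x y | [&& x \in X, y \in X & adj x y]].

(* G[X] is connected; the empty graph is not. *)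
Definition connected_on (X : {set V}) : bool :=
  (X != set0) && [forall x in X, forall y in X, connect (induced_adj X) x y].

Definition connected_ksets (k : nat) : {set {set V}} :=
  [set X : {set V} | (#|X| == k) && connected_on X].

(* ucycle also accepts the degenerate closed walks [::] and [:: x; y]; the
   graph cycles are those of length at least 3. *)
Definition acyclic : Prop :=
  forall c : seq V, ucycle adj c -> size c < 3.

Definition is_tree : Prop := connected_on [set: V] /\ acyclic.

Definition is_path_graph : Prop :=
  exists v : 'I_#|V| -> V, bijective v /\
    forall i j : 'I_#|V|, adj (v i) (v j) = (i.+1 == j) || (j.+1 == i).

End Graphs.

(* Main.v *)
Require Import Defs.
From mathcomp Require Import all_boot.
From mathcomp Require Import perm zify.

(** (a) The connected [k]-sets determine the connected [j]-sets for all [j >= k]: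
    a set of size [k + 1 >= 3] is connected iff it is the union of two distinct
    connected [k]-sets.  Now let [uv] be an edge of [T1] and let [A] be the
    component of [u] in [T1 - v]; exchanging [u] and [v] we may assume [|A| >= k].
    Since [A] and [A + v] are connected in [T2], [v] has a unique [T2]-neighbour
    [u'] in [A], and [A] has no other [T2]-edge to its complement.  If [u' <> u],
    let [M] be the component of [u] in [T1 - u'].  Both [M] and its complement [D]
    are [T1]-connected, and one of them has at least [k] elements.  If it is [M],
    then [M] is [T2]-connected although it avoids the only [T2]-edge [u'v] leaving
    [A].  If it is [D], then [D + v] is connected in [T2] but not in [T1].

    (b) Every connected [k]-set of a path contains all the middle vertices
    [v_(n-k), ..., v_(k-1)], of which there are at least two; exchange two
    consecutive ones. *)

Set Implicit Arguments.
Unset Strict Implicit.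
Unset Printing Implicit Defensive.

Lemma connect_closed (V : finType) (e : rel V) (P : V -> Prop) x y :
  (forall z t, e z t -> P z -> P t) -> connect e x y -> P x -> P y.
Proof.
move=> eP /connectP[p]; elim: p x => [|z p IHp] x /= => [_ -> //|].
by case/andP=> exz zp ylast Px; apply: (IHp z) => //; apply: eP exz Px.
Qed.

(** * Connected vertex sets: crossing edges, growth and unions *)

Section ConnectedSets.

Variables (V : finType) (G : sgraph V).
Implicit Types (S X Y A : {set V}) (x y z v : V).

Lemma induced_connect_sym S : connect_sym (induced_adj G S).
Proof.
by apply: sym_connect_sym => x y; rewrite /induced_adj /= adj_sym andbCA.
Qed.

Lemma induced_connect_sub S X : S \subset X ->
  subrel (connect (induced_adj G S)) (connect (induced_adj G X)).
Proof.
move=> /subsetP SX; apply: connect_sub => x y /and3P[xS yS xy].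
by apply: connect1; rewrite /induced_adj /= !SX.
Qed.

Lemma connected_onP S x : x \in S ->
  (forall y, y \in S -> connect (induced_adj G S) x y) -> connected_on G S.
Proof.
move=> xS Sx; apply/andP; split; first by apply/set0Pn; exists x.
apply/forall_inP => y yS; apply/forall_inP => z zS.
by apply: (@connect_trans _ _ x); rewrite ?Sx // induced_connect_sym Sx.
Qed.

Lemma connected_on_connect S x y : connected_on G S -> x \in S -> y \in S ->
  connect (induced_adj G S) x y.
Proof. by case/andP=> _ /forall_inP h /h /forall_inP h2 /h2. Qed.

Lemma connected_on1 x : connected_on G [set x].
Proof. by apply: (@connected_onP _ x); [rewrite inE | move=> y /set1P->]. Qed.

(** The cut form of connectedness: if no edge inside [S] left [A], everything reachable from [x]
    within [S] would stay in [A], including [y]. *)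
Lemma connected_on_cross S A x y : connected_on G S ->
  x \in S -> x \in A -> y \in S -> y \notin A ->
  exists z t, [/\ z \in S, z \in A, t \in S, t \notin A & adj G z t].
Proof.
move=> cS xS xA yS yA; case: (boolP [exists z in S, exists t in S,
    [&& z \in A, t \notin A & adj G z t]]) => [|noedge].
  by case/exists_inP=> z zS /exists_inP[t tS /and3P[zA tA zt]]; exists z, t.
have := connected_on_connect cS xS yS.
move=> /(@connect_closed _ _ (fun z => z \in A)) yinA; case/negP: yA; apply: yinA => //.
move=> z t /and3P[zS tS zt] zA; apply: contraR noedge => tA.
by apply/exists_inP; exists z => //; apply/exists_inP; exists t => //; apply/and3P.
Qed.

Lemma connected_onU1 S x v : connected_on G S -> x \in S -> adj G v x ->
  connected_on G (v |: S).
Proof.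
move=> cS xS vx; apply: (@connected_onP _ x); first by rewrite !inE xS orbT.
move=> y /setU1P[->|yS].
  by apply: connect1; rewrite /induced_adj /= !inE xS eqxx orbT adj_sym.
by apply: induced_connect_sub (connected_on_connect cS xS yS); apply: subsetUr.
Qed.

Lemma connected_onU1_adj S v : connected_on G (v |: S) -> S != set0 ->
  v \notin S -> exists2 x, x \in S & adj G v x.
Proof.
move=> cS /set0Pn[x xS] vS.
have [||||z [t [_ /set1P-> /setU1P[->|tS] tv vt]]] :=
  @connected_on_cross (v |: S) [set v] v x cS.
- by rewrite !inE eqxx.
- by rewrite inE.
- by rewrite !inE xS orbT.
- by rewrite inE; apply: contraNneq vS => <-.
- by rewrite inE eqxx in tv.
- by exists t.
Qed.

Lemma connected_onU X Y x : connected_on G X -> connected_on G Y ->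
  x \in X -> x \in Y -> connected_on G (X :|: Y).
Proof.
move=> cX cY xX xY; apply: (@connected_onP _ x); first by rewrite inE xX.
move=> y /setUP[yX|yY].
  by apply: induced_connect_sub (connected_on_connect cX xX yX); apply: subsetUl.
by apply: induced_connect_sub (connected_on_connect cY xY yY); apply: subsetUr.
Qed.

(** Greedy growth from [[set x]]: while [X] is proper in [S], some edge inside [S] leaves [X], and
    its outer end is added. *)
Lemma connected_on_subset_card S x m : connected_on G S -> x \in S ->
  0 < m <= #|S| -> exists2 X, connected_on G X & [/\ x \in X, X \subset S & #|X| = m].
Proof.
move=> cS xS; elim: m => // -[_ _|m IHm lt_m].
  by exists [set x]; [apply: connected_on1 | rewrite inE eqxx sub1set cards1].
have [|X cX [xX XS cardX]] := IHm; first by case/andP: lt_m => _ /ltnW.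
have /properP[_ [y yS yX]] : X \proper S.
  by rewrite properEcard XS cardX; case/andP: lt_m.
have [z [t [zS zX tS tX zt]]] := connected_on_cross cS xS xX yS yX.
exists (t |: X); first by apply: connected_onU1 cX zX _; rewrite adj_sym.
by rewrite !inE xX orbT subUset sub1set tS XS cardsU1 tX cardX.
Qed.

(** * Components of a graph with one vertex deleted, and cycles through that vertex *)

Definition component_del w u : {set V} :=
  [set x | connect (induced_adj G [set~ w]) u x].

Lemma component_del_root w u : u \in component_del w u.
Proof. by rewrite inE. Qed.

Lemma component_del_neq w u x : u != w -> x \in component_del w u -> x != w.
Proof.
move=> uw; rewrite inE => /(@connect_closed _ _ (fun z => z != w)); apply=> //.
by move=> z t /and3P[_]; rewrite !inE.
Qed.

Lemma component_del_adj w u x y : u != w ->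
  x \in component_del w u -> adj G x y -> y != w -> y \in component_del w u.
Proof.
move=> uw xC xy yw; have xw := component_del_neq uw xC.
rewrite inE in xC; rewrite inE; apply: connect_trans xC (connect1 _).
by rewrite /induced_adj /= !inE xw yw.
Qed.

Lemma component_del_connected w u : u != w -> connected_on G (component_del w u).
Proof.
move=> uw; apply: (@connected_onP _ u); first exact: component_del_root.
move=> y; rewrite inE => uy.
(* Membership is carried along with reachability, since each new edge must be shown to lie inside
   the component. *)
suff [] : y \in component_del w u /\
  connect (induced_adj G (component_del w u)) u y by [].
apply: (@connect_closed _ _ (fun y => y \in component_del w u /\
  connect (induced_adj G (component_del w u)) u y)) uy _ => [z t|].
  case/and3P=> zw tw zt [zC uz]; rewrite !inE in zw tw.
  have tC := component_del_adj uw zC zt tw.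
  by split=> //; apply: connect_trans uz (connect1 _); apply/and3P.
by split; [apply: component_del_root | apply: connect0].
Qed.

(** Every vertex of the complement reaches [w] inside it. Otherwise an edge leaves its reachable
    part [R]; the outer end is not in the component, which would absorb the inner end, so it belongs
    to [R] after all. *)
Lemma component_delC_connected w u : u != w -> connected_on G [set: V] ->
  connected_on G (~: component_del w u).
Proof.
move=> uw cV; set D := ~: _.
have wD : w \in D by rewrite inE; apply/negP => /(component_del_neq uw); rewrite eqxx.
apply: (@connected_onP _ w) => // x xD; rewrite induced_connect_sym.
pose R := [set y in D | connect (induced_adj G D) x y].
have [wR|wR] := boolP (w \in R); first by case/setIdP: wR.
have xR : x \in R by rewrite inE xD connect0.
have [z [t [_ zR _ tR zt]]] := connected_on_cross cV (in_setT x) xR (in_setT w) wR.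
have [zD xz] := setIdP zR; case/negP: tR; rewrite inE.
have tD : t \in D.
  rewrite inE; apply/negP => tC; move: zD; rewrite inE => /negP; apply.
  apply: component_del_adj tC _ _ => //; first by rewrite adj_sym.
  by apply: contraNneq wR => <-.
by rewrite tD; apply: connect_trans xz (connect1 _); apply/and3P.
Qed.

(** Two distinct neighbours of [v] in [S] would be joined by a simple path inside [S], which closes
    up through [v] to a cycle. *)
Lemma acyclic_adj_connected_uniq S v x y : acyclic G -> connected_on G S ->
  v \notin S -> x \in S -> y \in S -> adj G v x -> adj G v y -> x = y.
Proof.
move=> acG cS vS xS yS vx vy; apply/eqP/negPn/negP => xy.
have /connectP[q qpath qlast] := connected_on_connect cS xS yS.
rewrite {}qlast in yS xy vy *; case/shortenP: qpath yS xy vy => p ppath puniq _ yS xy vy.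
have pS z : z \in x :: p -> z \in S.
  rewrite inE => /predU1P[-> //|].
  elim: p x ppath {xS vx puniq yS xy vy} => //= t p IHp x /andP[/and3P[_ tS _] tp].
  by rewrite inE => /predU1P[-> //|]; apply: IHp tp.
have padj : path (adj G) x p by apply: sub_path ppath => z t /and3P[].
(* The cycle has at least three vertices because [x] differs from the end of [p], so [p] is not
   empty. *)
have := acG (v :: x :: p); rewrite /ucycle /= rcons_path vx padj adj_sym vy /=.
have -> : v \notin x :: p by apply: contra vS => /pS.
rewrite -[_ && uniq p]/(uniq (x :: p)) puniq => /(_ isT).
by case: p xy {ppath pS padj puniq yS vy} => [|z p] //=; rewrite eqxx.
Qed.

(** An edge leaving the union would end outside both [u] and [v], hence stay in the component where
    it starts. *)
Lemma adj_component_cover u v : connected_on G [set: V] -> adj G u v ->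
  component_del v u :|: component_del u v = [set: V].
Proof.
move=> cV uv; have nuv : u != v by apply: contraTneq uv => ->; rewrite adj_irrefl.
have nvu : v != u by rewrite eq_sym.
apply/setP => y; rewrite in_setT; apply/negPn/negP => yN.
have uU : u \in component_del v u :|: component_del u v.
  by rewrite inE component_del_root.
have [z [t [_ /setUP zU _ tU zt]]] := connected_on_cross cV (in_setT u) uU (in_setT y) yN.
case/negP: tU; have [->|tv] := eqVneq t v; first by rewrite inE component_del_root orbT.
have [-> //|tu] := eqVneq t u.
rewrite inE; case: zU => zC; apply/orP; [left|right].
  exact: component_del_adj zC zt tv.
exact: component_del_adj zC zt tu.
Qed.

End ConnectedSets.

(** If both parts were smaller than the ceiling of [n]/2, their sum would be at most [n - 1]. This
    is where the upper bound on [k] in (a) enters. *)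
Lemma leq_uphalf_add n k a b : k <= uphalf n -> n <= a + b -> (k <= a) || (k <= b).
Proof. lia. Qed.

(** * Trees are determined by their connected [k]-sets *)

Section Reconstruction.

Variable V : finType.
Implicit Types (G H T : sgraph V) (S X : {set V}).

Lemma connected_ksets_succ_sub G H k : 2 <= k ->
  connected_ksets G k = connected_ksets H k ->
  forall X, #|X| = k.+1 -> connected_on G X -> connected_on H X.
Proof.
move=> k2 eqGH X cardX cX.
have GH (Y : {set V}) : #|Y| = k -> connected_on G Y -> connected_on H Y.
  by move=> cardY; move/setP/(_ Y): eqGH; rewrite !inE cardY eqxx /= => ->.
have k_le : 0 < k <= #|X| by lia.
have /set0Pn[x xX] : X != set0 by rewrite -card_gt0; lia.
have [Y cY [xY YX cardY]] := connected_on_subset_card cX xX k_le.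
have /properP[_ [y yX yY]] : Y \proper X by rewrite properEcard YX cardY cardX ltnSn.
(* [Y] misses only [y], so any connected [k]-subset through [y] completes it to [X]. *)
have [Z cZ [yZ ZX cardZ]] := connected_on_subset_card cX yX k_le.
have XE : Y :|: Z = X.
  apply/eqP; rewrite eqEcard subUset YX ZX cardX -cardY -add1n.
  have -> : 1 + #|Y| = #|y |: Y| by rewrite cardsU1 yY.
  by apply: subset_leq_card; rewrite setUC setUS // sub1set.
(* The overlap has [2k - (k + 1) = k - 1] elements, at least one as [k >= 2]. *)
have /set0Pn[z /setIP[zY zZ]] : Y :&: Z != set0.
  by rewrite -card_gt0; have := cardsUI Y Z; rewrite XE cardX cardY cardZ; lia.
by rewrite -XE; apply: connected_onU zY zZ; apply: GH.
Qed.

Lemma connected_ksets_geq G H k j : 2 <= k <= j ->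
  connected_ksets G k = connected_ksets H k ->
  connected_ksets G j = connected_ksets H j.
Proof.
case/andP=> k2 /subnK <-; elim: (j - k) => // i IHi eqk.
have {eqk}IHi := IHi eqk; have ik2 : 2 <= i + k by lia.
apply/setP => X; rewrite !inE addSn; case: eqP => //= cardX.
by apply/idP/idP; apply: connected_ksets_succ_sub cardX => //; apply: esym.
Qed.

Lemma connected_on_geq G H k X : 2 <= k <= #|X| ->
  connected_ksets G k = connected_ksets H k ->
  connected_on G X = connected_on H X.
Proof. by move=> kX /(connected_ksets_geq kX)/setP/(_ X); rewrite !inE eqxx. Qed.

Lemma tree_adj_of_ksets T1 T2 k u v : is_tree T1 -> is_tree T2 ->
  2 <= k -> k <= uphalf #|V| -> connected_ksets T1 k = connected_ksets T2 k ->
  adj T1 u v -> k <= #|component_del T1 v u| -> adj T2 u v.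
Proof.
move=> [cT1 acT1] [_ acT2] k2 kn eqk uv kA; set A := component_del T1 v u in kA.
have eqc X : k <= #|X| -> connected_on T1 X = connected_on T2 X.
  by move=> kX; apply: connected_on_geq eqk; rewrite k2.
have uv_neq : u != v by apply: contraTneq uv => ->; rewrite adj_irrefl.
have uA : u \in A by apply: component_del_root.
have vA : v \notin A by apply/negP => /(component_del_neq uv_neq); rewrite eqxx.
have cA1 : connected_on T1 A by apply: component_del_connected.
have kA1 y : k <= #|y |: A| by apply: leq_trans kA (subset_leq_card (subsetUr _ _)).
have A0 : A != set0 by apply/set0Pn; exists u.
have cA2 : connected_on T2 A by rewrite -eqc.
have cAv2 : connected_on T2 (v |: A).
  by rewrite -eqc //; apply: connected_onU1 cA1 uA _; rewrite adj_sym.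
have [u' u'A vu'] := connected_onU1_adj cAv2 A0 vA.
(* A vertex [y] outside [A] that is [T2]-adjacent to [A] makes [y |: A] connected in [T2], hence in
   [T1]; but only [v] is joined to [A] from outside in [T1]. *)
have cross2 x y : x \in A -> y \notin A -> adj T2 x y -> y = v.
  move=> xA yA xy; have : connected_on T1 (y |: A).
    by rewrite eqc //; apply: connected_onU1 cA2 xA _; rewrite adj_sym.
  move=> /connected_onU1_adj/(_ A0 yA)[z zA yz]; apply/eqP; apply: contraNT yA.
  by apply: component_del_adj zA _ => //; rewrite adj_sym.
have [<-|u'u] := eqVneq u' u; first by rewrite adj_sym.
have uu' : u != u' by rewrite eq_sym.
set M := component_del T1 u' u; set D := ~: M.
have uM : u \in M by apply: component_del_root.
have vu'_neq : v != u' by apply: contraNneq vA => ->.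
have vM : v \in M by apply: component_del_adj uM uv _.
have u'M : u' \notin M by apply/negP => /(component_del_neq uu'); rewrite eqxx.
have /orP[kM|kD] : (k <= #|M|) || (k <= #|D|).
- by apply: leq_uphalf_add kn _; rewrite cardsC.
(* A [T2]-edge inside [M] leaves [A], so it ends at [v]; it must start at the unique neighbour [u'],
   which is not in [M]. *)
- have cM : connected_on T2 M by rewrite -(eqc _ kM); exact: component_del_connected uu'.
  have [x [y [xM xA yM yA xy]]] := connected_on_cross cM uM uA vM vA.
  have vx : adj T2 v x by rewrite adj_sym -(cross2 _ _ xA yA xy).
  by rewrite (acyclic_adj_connected_uniq acT2 cA2 vA u'A xA vu' vx) xM in u'M.
have vD : v \notin D by rewrite inE negbK.
have u'D : u' \in D by rewrite inE.
have cD1 : connected_on T1 D by apply: component_delC_connected.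
have : connected_on T1 (v |: D).
  rewrite eqc; last by apply: leq_trans kD (subset_leq_card (subsetUr _ _)).
  by apply: connected_onU1 u'D vu'; rewrite -eqc.
move=> /connected_onU1_adj[||x xD vx] //; first by apply/set0Pn; exists u'.
(* A [T1]-neighbour of [v] other than [u'] lies in [M], not in [D]; and [u'] itself would be a
   second [T1]-neighbour of [v] in [A], besides [u]. *)
have [xu'|xu'] := eqVneq x u'; last first.
  by move: xD; rewrite inE (component_del_adj uu' vM vx xu').
rewrite {}xu' in vx; have vu : adj T1 v u by rewrite adj_sym.
by rewrite (acyclic_adj_connected_uniq acT1 cA1 vA uA u'A vu vx) eqxx in uu'.
Qed.

Lemma tree_edges_sub_of_ksets T1 T2 k : is_tree T1 -> is_tree T2 ->
  2 <= k -> k <= uphalf #|V| -> connected_ksets T1 k = connected_ksets T2 k ->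
  edges T1 \subset edges T2.
Proof.
move=> tT1 tT2 k2 kn eqk; apply/subsetP => e eT1.
have /forall_inP/(_ _ eT1)/cards2P[u [v [_ eE]]] := edges_card2 T1.
subst e; have uv : adj T1 u v by [].
(* The two components cover all vertices, so one is large enough; the second case is the first with
   [u] and [v] exchanged. *)
have /orP[kA|kB] : (k <= #|component_del T1 v u|) || (k <= #|component_del T1 u v|).
- apply: leq_uphalf_add kn _; rewrite -cardsUI adj_component_cover ?cardsT ?leq_addr //.
  by case: tT1.
- exact: (tree_adj_of_ksets tT1 tT2 k2 kn eqk uv kA).
have vu : adj T1 v u by rewrite adj_sym.
by have := tree_adj_of_ksets tT1 tT2 k2 kn eqk vu kB; rewrite adj_sym.
Qed.

End Reconstruction.

(** * Relabelling a path by transposing two middle vertices *)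

Section Pullback.

Variables (V : finType) (s : {perm V}).

Lemma pullback_card2 (G : sgraph V) :
  [forall e in [set e : {set V} | s @: e \in edges G], #|e| == 2].
Proof.
apply/forall_inP => e; rewrite inE => se.
by have /forall_inP/(_ _ se) := edges_card2 G; rewrite card_imset //; apply: perm_inj.
Qed.

(** Taking preimages of edges makes [s] an isomorphism from the pullback onto [G]. *)
Definition pullback (G : sgraph V) : sgraph V := SGraph (pullback_card2 G).

Lemma adj_pullback G x y : adj (pullback G) x y = adj G (s x) (s y).
Proof. by rewrite /adj /= inE imsetU !imset_set1. Qed.

End Pullback.

Lemma connected_on_imset (V : finType) (G H : sgraph V) (f : V -> V) X :
  {homo f : x y / adj G x y >-> adj H x y} ->
  connected_on G X -> connected_on H (f @: X).
Proof.
move=> fGH cX; have /set0Pn[x xX] : X != set0 by case/andP: cX.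
apply: (@connected_onP _ _ _ (f x)) => [|_ /imsetP[y yX ->]]; first exact: imset_f.
have := connected_on_connect cX xX yX.
move=> /(@connect_closed _ _ (fun z => connect (induced_adj H (f @: X)) (f x) (f z))).
apply; last exact: connect0.
move=> z t /and3P[zX tX zt] xz; apply: connect_trans xz (connect1 _).
by rewrite /induced_adj /= !imset_f // fGH.
Qed.

Lemma imset_tperm (V : finType) (a b : V) (X : {set V}) :
  a \in X -> b \in X -> tperm a b @: X = X.
Proof.
move=> aX bX; apply/eqP; rewrite eqEcard card_imset ?leqnn ?andbT; last exact: perm_inj.
by apply/subsetP => _ /imsetP[x xX ->]; case: tpermP.
Qed.

Lemma card_ord_lt n (m : 'I_n) : #|[set i : 'I_n | i < m]| = m.
Proof.
have inj : injective (widen_ord (ltnW (ltn_ord m))) by move=> i j [] /val_inj.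
rewrite -[RHS](card_ord m) -cardsT -(card_imset _ inj).
congr #|pred_of_set _|; apply/setP => i; rewrite inE; apply/idP/imsetP => [im|[j _ ->]].
  by exists (Ordinal im) => //; apply: val_inj.
exact: (ltn_ord j).
Qed.

(** Deleting [v m] splits the path into [m] vertices before it and [#|V| - m - 1] after it. Both
    numbers are below [#|X|], so [X] meets both sides and cannot avoid [v m]. *)
Lemma path_connected_middle (V : finType) (P : sgraph V) (v : 'I_#|V| -> V) X (m : 'I_#|V|) :
  bijective v ->
  (forall i j : 'I_#|V|, adj P (v i) (v j) = (i.+1 == j) || (j.+1 == i)) ->
  connected_on P X -> #|V| <= #|X| + m -> m < #|X| -> v m \in X.
Proof.
move=> [w wK vK] vadj cX Xm mX; apply/negPn/negP => vmX.
have injv : injective v by apply: can_inj wK.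
have cardL : #|v @: [set i : 'I_#|V| | i < m]| = m by rewrite card_imset // card_ord_lt.
set L := v @: _ in cardL.
have inL i : (v i \in L) = (i < m).
  by rewrite mem_imset // inE.
have /subsetPn[y yX yL] : ~~ (X \subset L).
  by apply/negP => /subset_leq_card; rewrite cardL; lia.
have /subsetPn[x xX xL] : ~~ (X \subset ~: (v m |: L)).
  apply/negP => /subset_leq_card; have := cardsC (v m |: L).
  by rewrite cardsU1 inL ltnn cardL; lia.
have {}xL : x \in L.
  by move: xL; rewrite !inE negbK => /predU1P[xE|//]; rewrite xE (negPf vmX) in xX.
have [z [t []]] := connected_on_cross cX xX xL yX yL.
rewrite -(vK z) -(vK t) !inL vadj => zX zm tX tm.
(* The crossing edge would join an index below [m] to one above [m], but adjacent indices differ by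
   one. *)
have : w t != m :> nat by apply: contraNneq vmX => /val_inj <-.
by move: zm tm; lia.
Qed.

(** The witness [n - k] is the first middle index; the next one is still below [k] because
    [2k >= n + 2]. *)
Lemma middle_pair n k : 3 <= n -> uphalf n < k <= n ->
  exists d, [/\ d < n, d.+1 < n, d.+1 < k & n <= k + d].
Proof. by move=> n3 nk; exists (n - k); split; lia. Qed.

Lemma path_ksets_ambiguous (V : finType) (P : sgraph V) k :
  3 <= #|V| -> uphalf #|V| < k <= #|V| -> is_path_graph P ->
  exists P' : sgraph V, [/\ is_path_graph P', P' <> P &
    connected_ksets P' k = connected_ksets P k].
Proof.
move=> n3 nk [v [bijv vadj]].
have injv := bij_inj bijv.
have [d [am bm dk nkd]] := middle_pair n3 nk.
pose i := Ordinal am; pose j := Ordinal bm; pose s := tperm (v i) (v j).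
have sK : involutive s by apply: tpermK.
have homo1 : {homo s : x y / adj P x y >-> adj (pullback s P) x y}.
  by move=> x y; rewrite adj_pullback !sK.
have homo2 : {homo s : x y / adj (pullback s P) x y >-> adj P x y}.
  by move=> x y; rewrite adj_pullback.
have fixP (X : {set V}) : #|X| = k -> connected_on P X -> s @: X = X.
  move=> cardX cX; apply: imset_tperm; apply: (path_connected_middle bijv vadj cX);
    rewrite cardX ?addnS //; [exact: ltnW | exact: leqW].
exists (pullback s P); split.
- exists (s \o v); split; first by apply: bij_comp bijv; exists s.
  by move=> x y; rewrite adj_pullback /= !sK vadj.
- move=> PE; have sadj x y : adj P (s x) (s y) = adj P x y by rewrite -adj_pullback PE.
  (* A third vertex adjacent to exactly one of the swapped two detects the change: index 2 when [d]
     is 0, and [d - 1] otherwise. *)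
  have [d0|d_gt0] := posnP d.
    have := sadj (v j) (v (Ordinal n3)).
    by rewrite tpermR tpermD ?(inj_eq injv) -?val_eqE /= ?vadj /= ?d0.
  have ltp : d.-1 < #|V| := leq_ltn_trans (leq_pred d) am.
  have := sadj (v (Ordinal ltp)) (v i).
  by rewrite tpermL tpermD ?(inj_eq injv) -?val_eqE /= ?vadj /=; move: d_gt0; clear; lia.
apply/setP => X; rewrite !inE; case: eqP => //= cardX; apply/idP/idP => cX.
  (* For [X] connected in the pullback, [s @: X] is connected in [P] and so fixed by [s]; as [s] is
     an involution, [s @: X] is [X]. *)
  have cardsX : #|s @: X| = k by rewrite card_imset //; apply: perm_inj.
  have csX := connected_on_imset homo2 cX.
  have := fixP _ cardsX csX; rewrite -imset_comp.
  by rewrite (eq_imset _ (g := id)) ?imset_id => [->|x /=]; rewrite ?sK.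
by rewrite -(fixP X cardX cX); apply: connected_on_imset cX.
Qed.

(* [uphalf n] is the ceiling of n/2. *)
Theorem theorem5 (n : nat) (hn : 3 <= n) (V : finType) (hV : #|V| = n) :
  (forall k : nat, 2 <= k <= uphalf n ->
     forall T1 T2 : sgraph V, is_tree T1 -> is_tree T2 -> T1 <> T2 ->
       connected_ksets T1 k <> connected_ksets T2 k) /\
  (forall k : nat, uphalf n + 1 <= k <= n ->
     forall P : sgraph V, is_path_graph P ->
       exists P' : sgraph V, [/\ is_path_graph P', P' <> P &
         connected_ksets P' k = connected_ksets P k]).
Proof.
subst n; split=> k; last first.
  by rewrite addn1 => k_bounds P; apply: path_ksets_ambiguous.
case/andP=> k2 kn T1 T2 tT1 tT2 neqT eqk; apply: neqT; apply/sgraph_eq/eqP.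
by rewrite eqEsubset (tree_edges_sub_of_ksets tT1 tT2 k2 kn eqk)
  (tree_edges_sub_of_ksets tT2 tT1 k2 kn (esym eqk)).
Qed.
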